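(* For $n\ge 2$ let $$q_n=\left\lfloor\frac{n^2+n-2\log_2 n}{\log_2(12n(n-1))}\right\rfloor .$$ Then, as $n\to\infty$, almost all permutations in $G_n$ have complexity greater than $q_n$ with respect to the local logic gates; that is, the proportion of elements of the finite group $G_n$ whose complexity is greater than $q_n$ tends to $1$ as $n\to\infty$.
   Context: Binary strings of length $n$ are identified with vectors in $\mathbb Z_2^n$, where $\mathbb Z_2$ is the field with two elements. Local logic gate: let $\sigma$ be any permutation of the four-element set $\mathbb Z_2^2$ and let $1\le i<j\le n$. The induced permutation $\sigma_{i,j}$ of $\mathbb Z_2^n$ replaces the coordinates $(c_i,c_j)$ of a vector $(c_1,\dots,c_n)$ by the first and second components of $\sigma(c_i,c_j)$ respectively, and leaves all other coordinates unchanged. The permutations $\sigma_{i,j}$ are called local logic gates, and $G_n$ is the group of permutations of $\mathbb Z_2^n$ that they generate. The complexity of a permutation in $G_n$ is the minimum number of local logic gates whose composition is equal to that permutation. *)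

(* Defs.v *)
From HB Require Import structures.
From mathcomp Require Import all_boot all_order all_algebra all_fingroup.
From mathcomp Require Import all_classical all_reals all_analysis.

Set Implicit Arguments.
Unset Strict Implicit.
Unset Printing Implicit Defensive.

Import Order.TTheory GRing.Theory Num.Theory.
Import numFieldNormedType.Exports.

Local Open Scope ring_scope.

Notation bits n := 'rV['F_2]_n.

Notation bits2 := ('F_2 * 'F_2)%type.

Definition gate_fun n (s : {perm bits2}) (i j : 'I_n) (c : bits n) : bits n :=
  \row_k if k == i then (s (c 0 i, c 0 j)).1
         else if k == j then (s (c 0 i, c 0 j)).2
         else c 0 k.

Definition ordered_pair n := {ij : 'I_n * 'I_n | (ij.1 < ij.2)%N}.

Lemma gate_fun_inj n (s : {perm bits2}) (ij : ordered_pair n) :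
  injective (gate_fun s (val ij).1 (val ij).2).
Proof.
case: ij => -[i j] /= lt_ij c d /rowP eq_cd.
have neq_ji : (j == i) = false by apply/negbTE; rewrite neq_ltn lt_ij orbT.
have /perm_inj[eq_i eq_j] : s (c 0 i, c 0 j) = s (d 0 i, d 0 j).
  move: (eq_cd i) (eq_cd j); rewrite !mxE !eqxx neq_ji.
  by case: (s _) => a b; case: (s _) => a' b' /= -> ->.
apply/rowP => k; have := eq_cd k; rewrite !mxE.
by case: eqP => [-> //|_]; case: eqP => [-> //|_].
Qed.

Definition local_gate n (s : {perm bits2}) (ij : ordered_pair n) :
  {perm bits n} := perm (@gate_fun_inj n s ij).

Definition local_gates n : {set {perm bits n}} :=
  [set local_gate s ij | s : {perm bits2}, ij : ordered_pair n].

Definition gate_group n : {group {perm bits n}} := <<local_gates n>>%G.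

(* [p * q] in [{perm _}] applies [p] first, so [w] lists the gates in their
   order of application. *)
Definition circuit n (w : seq {perm bits n}) (p : {perm bits n}) : bool :=
  all (mem (local_gates n)) w && (p == \prod_(g <- w) g)%g.

Definition computable_with n (p : {perm bits n}) (k : nat) : bool :=
  [exists w : k.-tuple {perm bits n}, circuit w p].

Lemma gate_group_computable n (x : [subg gate_group n]) :
  exists k, computable_with (sgval x) k.
Proof.
have /gen_prodgP[k [c c_gate ->]] : sgval x \in <<local_gates n>>%g.
  exact: (subgP x).
exists k; apply/existsP; exists [tuple c i | i < k]; apply/andP; split.
  by apply/allP => _ /mapP[i _ ->]; apply: c_gate.
by rewrite big_tuple; apply/eqP/eq_bigr => i _; rewrite tnth_mktuple.
Qed.

(* The empty product is allowed, so the identity has complexity 0. *)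
Definition complexity n (x : [subg gate_group n]) : nat :=
  ex_minn (gate_group_computable x).

Definition log2 (R : realType) (x : R) : R := ln x / ln 2.

Definition q (R : realType) (n : nat) : int :=
  Num.floor ((n%:R ^+ 2 + n%:R - 2 * log2 n%:R)
             / log2 (12 * n%:R * (n%:R - 1)) : R).

Definition proportion_above (R : realType) (n : nat) (t : int) : R :=
  #|[set x : [subg gate_group n] | t < (complexity x)%:Z]|%:R
  / #|gate_group n|%:R.

(* Main.v *)
(** Counting.  There are at most [M = 12 n (n - 1)] gates and the identity is one
    of them, so at most [M ^ q_n <= 2 ^ (n^2 + n) / n^2] permutations have
    complexity at most [q_n].  On the other hand [G_n] has at least
    [2 ^ (n^2 + n) / 4] elements: it is transitive on the [2^n] vectors, and the
    pointwise stabiliser of [0, e_0, ..., e_(k-1)] moves [e_k] to each of the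
    [2^n - 2^k] vectors outside the span of [e_0, ..., e_(k-1)].  Hence the
    exceptional proportion is at most [4 / n^2]. *)

Require Import Defs.
From HB Require Import structures.
From mathcomp Require Import all_boot all_order all_algebra all_fingroup.
From mathcomp Require Import all_classical all_reals all_analysis.
From mathcomp Require Import zify ring.
Import Order.TTheory GRing.Theory Num.Theory.
Import numFieldNormedType.Exports.

Set Implicit Arguments.
Unset Strict Implicit.
Unset Printing Implicit Defensive.

Local Open Scope ring_scope.

(** * Flips and controlled flips of one coordinate *)

Lemma F2_eq01 (a : 'F_2) : a = 0 \/ a = 1.
Proof. by case: a => -[|[|]] // ?; [left|right]; apply: val_inj. Qed.

(** One gate on the coordinates [i] and [j] does it, with two cases because gates are indexed by
    increasing pairs. Taking [c] to be the identity gives a controlled flip, and [c] constantly 1 a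
    plain flip. *)
Lemma controlled_gate n (i j : 'I_n) (c : 'F_2 -> 'F_2) : i != j ->
  exists2 g, g \in gate_group n &
    forall x : bits n, g x = x + c (x 0 j) *: delta_mx 0 i.
Proof.
move=> neq_ij; have neq_ji : (j == i) = false by rewrite eq_sym (negbTE neq_ij).
case: (ltngtP i j) => [lt_ij|lt_ji|/val_inj eq_ij]; last by rewrite eq_ij eqxx in neq_ij.
- pose f (u : bits2) : bits2 := (u.1 + c u.2, u.2).
  have f_inj : injective f by move=> [a b] [a' b'] e; have /= := (congr1 fst e, congr1 snd e);
      case=> + eb; rewrite eb => /addIr->.
  exists (local_gate (perm f_inj) (Sub (i, j) lt_ij)).
    by apply/mem_gen/imset2P; exists (perm f_inj) (Sub (i, j) lt_ij).
  move=> x; apply/rowP => k; rewrite permE !mxE !SubK !permE /=.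
  case: (eqVneq k i) => [->|_]; first by rewrite mulr1.
  by rewrite mulr0 addr0; case: eqP => [->|].
- pose f (u : bits2) : bits2 := (u.1, u.2 + c u.1).
  have f_inj : injective f by move=> [a b] [a' b'] e; have /= := (congr1 fst e, congr1 snd e);
      case=> ea; rewrite ea => /addIr->.
  exists (local_gate (perm f_inj) (Sub (j, i) lt_ji)).
    by apply/mem_gen/imset2P; exists (perm f_inj) (Sub (j, i) lt_ji).
  move=> x; apply/rowP => k; rewrite permE !mxE !SubK !permE /=.
  case: (eqVneq k i) => [->|_]; first by rewrite (negbTE neq_ij) mulr1.
  by rewrite mulr0 addr0; case: eqP => [->|].
Qed.

(** Walk from [t] to [v] by flipping, one at a time, the coordinates where they differ; all of these
    lie in [I]. *)
Lemma flip_closed n (D : {pred bits n}) (I : {pred 'I_n}) (t v : bits n) :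
    (forall i x, i \in I -> x \in D -> x + delta_mx 0 i \in D) ->
    (forall i, i \notin I -> v 0 i = t 0 i) ->
  t \in D -> v \in D.
Proof.
move=> flipD eq_vt tD.
have -> : v = t + \sum_(i <- enum I) (v - t) 0 i *: delta_mx 0 i.
  rewrite big_enum big_mkcond -[LHS](subrKC t) [v - t in LHS]row_sum_delta; congr (_ + _).
  apply: eq_bigr => i _; case: ifPn => // /eq_vt vt_i.
  by rewrite !mxE vt_i subrr scale0r.
have: {subset enum I <= I} by move=> i; rewrite mem_enum.
elim: (enum I) => [|i s IHs] sI; first by rewrite big_nil addr0.
rewrite big_cons; set w := \sum_(_ <- _) _ in IHs *; rewrite addrCA addrC.
have wD : t + w \in D by apply: IHs => j js; apply: sI; rewrite inE js orbT.
have [->|->] := F2_eq01 ((v - t) 0 i); first by rewrite scale0r addr0.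
by rewrite scale1r; apply: flipD => //; apply: sI; rewrite mem_head.
Qed.

(** * Lower bound on the order of the gate group by a stabiliser chain *)

Definition frame n k : {set bits n} :=
  0 |: [set delta_mx 0 i | i : 'I_n & (i < k)%N].

(** Since 0 lies in every frame, the chain starts at [k = 0] with the stabiliser of 0; each further
    step fixes one more unit vector. *)
Definition frame_stab n k : {group {perm bits n}} :=
  'C_(gate_group n)(frame n k | 'P)%G.

(** The flip of [i] controlled by [j] fixes 0 and every [e_l] with [l < k <= j], because the control
    coordinate of these vectors is 0. *)
Lemma frame_stab_flip n k (i j : 'I_n) (v : bits n) :
  (k <= j)%N -> i != j -> v 0 j = 1 ->
  v + delta_mx 0 i \in orbit 'P (frame_stab n k) v.
Proof.
move=> le_kj neq_ij vj; have [g gG gE] := controlled_gate id neq_ij.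
suff gK : g \in frame_stab n k.
  by have := mem_orbit 'P v gK; rewrite /= /aperm gE vj scale1r.
rewrite inE gG; apply/astabP => x; rewrite /= /aperm gE in_setU1.
case/predU1P => [->|/imsetP[l]]; first by rewrite mxE scale0r addr0.
rewrite inE => lt_lk ->; rewrite mxE eqxx /=.
have /negbTE-> : j != l by rewrite neq_ltn (leq_trans lt_lk) ?orbT.
by rewrite scale0r addr0.
Qed.

Lemma frame_stab_orbit n (k j : 'I_n) (v : bits n) :
  (k <= j)%N -> v 0 j != 0 -> v \in orbit 'P (frame_stab n k) (delta_mx 0 k).
Proof.
move=> le_kj; have [->|vj _] := F2_eq01 (v 0 j); first by rewrite eqxx.
set O := orbit _ _ _.
have flipO (i l : 'I_n) (x : bits n) : (k <= l)%N -> i != l -> x 0 l = 1 ->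
    (x + delta_mx 0 i \in O) = (x \in O).
  move=> le_kl neq_il xl; apply: orbit_transl.
  exact: frame_stab_flip le_kl neq_il xl.
have unitO (x : bits n) : x 0 k = 1 -> x \in O.
  (* The condition [x 0 k == 1] is carried along the walk because it keeps the control active. *)
  move=> xk; suff: x \in [pred x : bits n | (x \in O) && (x 0 k == 1)].
    by case/andP.
  apply: (@flip_closed _ _ (predC1 k) (delta_mx 0 k)) => [i y||].
  - rewrite !inE => neq_ik /andP[yO /eqP yk]; rewrite (flipO i k) // yO !mxE yk.
    by rewrite [k == i]eq_sym (negbTE neq_ik) addr0 eqxx.
  - by move=> i; rewrite inE negbK => /eqP->; rewrite xk mxE !eqxx.
  - by rewrite inE orbit_refl mxE !eqxx.
(* Flip coordinate [k] on, controlled by [j]; then [k] controls all other flips. *)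
have [vk|/unitO//] := F2_eq01 (v 0 k).
have neq_kj : k != j by apply/eqP => eq_kj; rewrite -eq_kj vk in vj.
by rewrite -(flipO k j) ?unitO // !mxE vk add0r !eqxx.
Qed.

(** The span of [e_0, ..., e_(k-1)], given by vanishing coordinates so that a vector outside it
    exhibits a control coordinate [j >= k]. *)
Definition low_support n k : {set bits n} :=
  [set v : bits n | [forall j : 'I_n, (k <= j)%N ==> (v 0 j == 0)]].

Lemma card_low_support n k : (k <= n)%N ->
  (#|low_support n k| <= 2 ^ k)%N.
Proof.
move=> le_kn; pose f (v : bits n) : bits k := \row_i v 0 (widen_ord le_kn i).
have cardk : #|{: bits k}| = (2 ^ k)%N by rewrite card_mx card_Fp // mul1n.
rewrite -cardk -(@card_in_imset _ _ f) ?max_card // => u v.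
rewrite !inE => /forallP u0 /forallP v0 /rowP eq_uv; apply/rowP => j.
case: (leqP k j) => [le_kj|lt_jk].
  by rewrite (eqP (implyP (u0 j) le_kj)) (eqP (implyP (v0 j) le_kj)).
have := eq_uv (Ordinal lt_jk); rewrite !mxE.
by rewrite (_ : widen_ord _ _ = j) //; apply: val_inj.
Qed.

Lemma card_frame_stabS n (k : 'I_n) :
  ((2 ^ n - 2 ^ k) * #|frame_stab n k.+1| <= #|frame_stab n k|)%N.
Proof.
rewrite -(card_orbit_stab 'P (frame_stab n k) (delta_mx 0 k)); apply: leq_mul.
  have : (#|~: low_support n k| <= #|orbit 'P (frame_stab n k) (delta_mx 0%R k)|)%N.
    apply: subset_leq_card; apply/fintype.subsetP => v; rewrite !inE negb_forall.
    by case/existsP => j; rewrite negb_imply => /andP[]; apply: frame_stab_orbit.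
  apply: leq_trans; rewrite cardsCs finset.setCK card_mx card_Fp // mul1n.
  by rewrite leq_sub2l // card_low_support // ltnW.
(* What remains is that fixing [frame n k] and [e_k] amounts to fixing [frame n k.+1]. *)
rewrite /= -finset.setIA -astabU.
apply: subset_leq_card; apply: finset.setIS; apply: astabS.
apply/fintype.subsetP => x; rewrite !inE -orbA; case: (x == 0) => //=.
case/orP => [/imsetP[i]|/eqP->]; last by rewrite imset_f // inE.
by rewrite inE => lt_ik ->; rewrite imset_f // inE ltnS ltnW.
Qed.

Lemma card_gate_group_prod n : (1 < n)%N ->
  (2 ^ n * \prod_(k < n) (2 ^ n - 2 ^ k) <= #|gate_group n|)%N.
Proof.
move=> n_gt1; rewrite -(card_orbit_stab 'P (gate_group n) 0).
apply: leq_mul.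
  suff -> : orbit 'P (gate_group n) 0 = [set: bits n] by rewrite cardsT card_mx card_Fp ?mul1n.
  apply/setP => v; rewrite inE.
  apply: (@flip_closed _ _ predT 0) => // [i x _ xO|]; last exact: orbit_refl.
  (* The flip of [i] is unconditional, but a gate needs a second coordinate; [1 < n] provides
     one. *)
  have [j neq_ij] : exists j : 'I_n, i != j.
    have [i0|i_gt0] := posnP i.
      by exists (Ordinal n_gt1); rewrite -val_eqE /= i0.
    by exists (Ordinal (ltnW n_gt1)); rewrite -val_eqE /= -lt0n.
  have [g gG gE] := controlled_gate (fun=> 1) neq_ij.
  apply: orbit_trans xO; have := mem_orbit 'P x gG.
  by rewrite /= /aperm gE scale1r.
suff main k : (k <= n)%N ->
    (\prod_(i < k) (2 ^ n - 2 ^ i) * #|frame_stab n k| <= #|frame_stab n 0|)%N.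
  apply: leq_trans (leq_trans (leq_pmulr _ (cardG_gt0 _)) (main n (leqnn n))) _.
  apply: subset_leq_card; apply: finset.setIS; apply: astabS.
  by rewrite finset.sub1set finset.setU11.
elim: k => [|k IHk] lt_kn; first by rewrite big_ord0 mul1n.
rewrite big_ord_recr -mulnA; apply: leq_trans (IHk (ltnW lt_kn)).
by rewrite leq_mul2l (card_frame_stabS (Ordinal lt_kn)) orbT.
Qed.

(* Bernoulli-type bound: the product of the [1 - 2^(k-n)] over [k < m] is at least
   [1 - 2^(m-n)].  It is useless at [m = n] and is applied at [m = n - 1]. *)
Lemma prod_subn_expn2 n m : (m <= n)%N ->
  (2 ^ (n * m) * (2 ^ n - 2 ^ m) <= 2 ^ n * \prod_(k < m) (2 ^ n - 2 ^ k))%N.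
Proof.
elim: m => [|m IHm] le_mn; first by rewrite muln0 mul1n big_ord0 muln1 leq_subr.
rewrite big_ord_recr /= mulnA; have := leq_mul (IHm (ltnW le_mn)) (leqnn (2 ^ n - 2 ^ m)).
apply: leq_trans; rewrite mulnS expnD [X in (X * _)%N]mulnC -!mulnA leq_mul2l.
(* With [a = 2 ^ n] and [b = 2 ^ m], this is [a (a - 2 b) <= (a - b)^2]. *)
apply/orP; right; have := leq_pexp2l (isT : 0 < 2)%N le_mn; rewrite expnS.
by move: (2 ^ n)%N (2 ^ m)%N => a b; nia.
Qed.

(** The constant 4 is two losses of a factor 2: the last factor of the product,
    [2 ^ n - 2 ^ (n - 1)], is half of [2 ^ n], and the product of the other factors is bounded with
    a second loss of one half. *)
Lemma card_gate_group_ge n : (1 < n)%N ->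
  (2 ^ (n ^ 2 + n) <= 4 * #|gate_group n|)%N.
Proof.
case: n => // n n_gt1; have := card_gate_group_prod n_gt1.
rewrite -(leq_pmul2l (isT : 0 < 4)%N); apply: leq_trans.
rewrite big_ord_recr /= mulnA; have := prod_subn_expn2 (leqnSn n).
have -> : (n.+1 ^ 2 + n.+1 = n.+1 * n + n + n + 2)%N by nia.
rewrite !expnD expnS; set P := \prod_(_ < _) _.
move: (2 ^ (n.+1 * n))%N P (2 ^ n)%N => a P b.
have -> : (2 * b - b = b)%N by lia.
nia.
Qed.

(** * Counting gates and circuits *)

Lemma card_expgs (gT : finGroupType) (A : {set gT}) k : (#|(A ^+ k)%g| <= #|A| ^ k)%N.
Proof.
elim: k => [|k IHk]; first by rewrite expg0 cards1.
have subX : (A ^+ k.+1 \subset [set u.1 * u.2 | u in finset.setX A (A ^+ k)])%g.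
  rewrite expgS; apply/fintype.subsetP => _ /mulsgP[a b aA bA ->].
  by apply/imsetP; exists (a, b); rewrite ?inE ?aA.
apply: leq_trans (subset_leq_card subX) _; apply: leq_trans (leq_imset_card _ _) _.
by rewrite cardsX expnS leq_mul2l IHk orbT.
Qed.

Lemma mem_prodg_expgs (gT : finGroupType) (A : {set gT}) (w : seq gT) :
  {in w, forall g, g \in A} -> (\prod_(g <- w) g \in A ^+ size w)%g.
Proof.
elim: w => [|g w IHw] wA; first by rewrite big_nil inE.
rewrite big_cons /= expgS mem_mulg ?wA ?mem_head // IHw // => h hw.
by apply: wA; rewrite inE hw orbT.
Qed.

Lemma card_ordered_pair n : #|{: ordered_pair n}| = 'C(n, 2).
Proof.
rewrite card_sig -bin2_sum big_mkord -sum1_card.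
rewrite -(pair_big_dep xpredT (fun i j : 'I_n => (i < j)%N) (fun _ _ => 1%N)) /=.
rewrite (exchange_big_dep xpredT) //=; apply: eq_bigr => j _.
by rewrite -(big_ord_widen _ (fun=> 1%N)) ?sum1_card ?card_ord // ltnW.
Qed.

Lemma card_local_gates n : (#|local_gates n| <= 12 * (n * n.-1))%N.
Proof.
(* There are 24 = 4! permutations of [bits2] for each of the ['C(n, 2)] pairs. *)
have -> : (12 * (n * n.-1) = 24 * 'C(n, 2))%N.
  by have := mul_bin_diag n 1; rewrite bin1 => ->; rewrite mulnA.
have card_perm2 : #|{perm bits2}| = 24%N.
  have := card_perm [set: bits2]; rewrite cardsT card_prod card_Fp // => card4.
  apply: etrans card4.
  by apply: eq_card => s; rewrite !inE; apply/esym/fintype.subsetP => x; rewrite inE.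
rewrite -card_ordered_pair -card_perm2 -card_prod /local_gates.
apply: leq_trans (leq_imset_card (fun u => local_gate u.1 u.2) predT).
apply: subset_leq_card; apply/fintype.subsetP => _ /imset2P[s ij _ _ ->].
by apply/imsetP; exists (s, ij).
Qed.

Lemma local_gates1 n : (1 < n)%N -> 1%g \in local_gates n.
Proof.
move=> n_gt1; pose i := Ordinal (ltnW n_gt1); pose j := Ordinal n_gt1.
pose ij : ordered_pair n := Sub (i, j) (isT : (i < j)%N).
apply/imset2P; exists 1%g ij => //; apply/permP => c; apply/rowP => k.
rewrite !permE !mxE SubK !perm1 /=.
by case: eqP => [->//|_]; case: eqP => [->|].
Qed.

(** The identity is a gate, so a shorter circuit can be padded to length exactly [k]; a single power
    of the gate set then covers all complexities up to [k], without a sum over lengths. *)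
Lemma card_complexity_le n k : (1 < n)%N ->
  (#|[set x : [subg gate_group n] | complexity x <= k]| <= (12 * (n * n.-1)) ^ k)%N.
Proof.
move=> n_gt1; apply: (@leq_trans (#|local_gates n| ^ k)); last first.
  by case: k => // k; rewrite leq_exp2r ?card_local_gates.
apply: leq_trans (card_expgs _ _); rewrite -(card_imset _ subg_inj).
apply: subset_leq_card; apply/fintype.subsetP => _ /imsetP[x + ->]; rewrite inE.
rewrite /complexity; case: ex_minnP => m /existsP[w /andP[/allP w_gates /eqP->]] _ le_mk.
rewrite -(subnK le_mk) expgD -[(\prod_(_ <- _) _)%g]mul1g; apply: mem_mulg.
  by elim: (k - m)%N => [|d IHd]; rewrite ?expg0 ?inE // expgS -[1%g]mulg1 mem_mulg ?local_gates1.
by have := mem_prodg_expgs w_gates; rewrite size_tuple.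
Qed.

(** * The choice of the threshold and the limit *)

Lemma powR_q_le (R : realType) n : (1 < n)%N ->
  (12 * (n * n.-1))%:R `^ (q R n)%:~R <= 2 ^+ (n ^ 2 + n) / n%:R ^+ 2 :> R.
Proof.
move=> n_gt1; have n_gt0 : 0 < n%:R :> R by rewrite ltr0n ltnW.
have ME : (12 * (n * n.-1))%:R = 12 * n%:R * (n%:R - 1) :> R.
  by rewrite !natrM -[n.-1]subn1 natrB ?mulrA // ltnW.
rewrite /q -ME; set M : R := (12 * _)%:R; set e := n%:R ^+ 2 + n%:R - 2 * log2 n%:R.
have M_gt1 : 1 < M by rewrite ltr1n; nia.
have ln2_gt0 : 0 < ln 2 :> R by rewrite ln_gt0 // ltr1n.
have lnM_gt0 : 0 < ln M by rewrite ln_gt0.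
(* As [M > 1], dropping the floor only increases the power. Then [M] to the [e / log2 M] is 2 to the
   [e], where the term [- 2 * log2 n] yields the division by [n ^ 2]. *)
apply: le_trans (ler_powR (ltW M_gt1) (Num.Theory.floor_le _)) _.
rewrite /powR gt_eqF ?(lt_trans _ M_gt1) //.
have -> : e / log2 M * ln M = (n ^ 2 + n)%:R * ln 2 - 2%:R * ln n%:R.
  rewrite /e /log2 natrD natrX; field.
  by rewrite !gt_eqF.
by rewrite expRD expRN !expRM_natl !lnK // posrE.
Qed.

Lemma card_complexity_le_q (R : realType) n : (1 < n)%N ->
  #|[set x : [subg gate_group n] | (complexity x)%:Z <= q R n]|%:R
    <= 2 ^+ (n ^ 2 + n) / n%:R ^+ 2 :> R.
Proof.
move=> n_gt1; apply: le_trans (powR_q_le R n_gt1).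
(* For a negative threshold the set is empty; otherwise the real power is a natural one. *)
case: (q R n) => k; last first.
  by rewrite eq_card0 ?powR_ge0 // => x; rewrite inE.
rewrite powR_mulrn // -natrX ler_nat.
exact: card_complexity_le.
Qed.

Lemma proportion_aboveE (R : realType) n t :
  proportion_above R n t =
    1 - #|[set x : [subg gate_group n] | (complexity x)%:Z <= t]|%:R / #|gate_group n|%:R.
Proof.
set B := [set x | _].
have cardG : #|{: [subg gate_group n]}| = #|gate_group n|.
  by rewrite (card_isog (isog_subg (gate_group n))) cardsT.
have G_neq0 : #|gate_group n|%:R != 0 :> R by rewrite pnatr_eq0 -lt0n cardG_gt0.
rewrite /proportion_above (_ : #|_| = #|~: B|)%N; last first.
  by apply: eq_card => x; rewrite !inE ltNge.
rewrite cardsCs finset.setCK cardG natrB; last by rewrite -cardG max_card.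
by rewrite mulrBl divff.
Qed.

Local Open Scope classical_set_scope.

Theorem theorem4p2 (R : realType) :
  (fun n : nat => proportion_above R n (q R n)) @ \oo --> (1 : R).
Proof.
(* Here [harmonic n] is [1 / (n + 1)], and the exceptional proportion [4 / n^2] is at most
   [8 / (n + 1)] because [n + 1 <= 2 n^2]. *)
apply: (@squeeze_cvgr _ _ _ _ (fun n => 1 - 8 * harmonic n) (fun=> 1)); last 2 first.
- rewrite -[X in _ --> X]subr0 -[X in _ - X](mulr0 8).
  by apply: cvgB; [exact: cvg_cst|apply: cvgMr; exact: cvg_harmonic].
- exact: cvg_cst.
near=> n; have n_gt1 : (1 < n)%N by near: n; exists 2.
have n_gt0 : 0 < n%:R :> R by rewrite ltr0n ltnW.
have G_gt0 : 0 < #|gate_group n|%:R :> R by rewrite ltr0n cardG_gt0.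
rewrite proportion_aboveE gerBl ?divr_ge0 // andbT lerB //.
rewrite ler_pdivrMr //; apply: le_trans (card_complexity_le_q R n_gt1) _.
rewrite ler_pdivrMr ?exprn_gt0 //.
have : 2 ^+ (n ^ 2 + n) <= 4 * #|gate_group n|%:R :> R.
  by rewrite -natrX -natrM ler_nat card_gate_group_ge.
move=> /le_trans; apply.
have -> : 8 * harmonic n * #|gate_group n|%:R * n%:R ^+ 2
          = 4 * #|gate_group n|%:R * (2 * n%:R ^+ 2 / n.+1%:R) :> R.
  by rewrite /=; ring.
rewrite ler_peMr ?mulr_ge0 // ler_pdivlMr // mul1r -natrX -natrM ler_nat.
nia.
Unshelve. all: by end_near.
Qed.
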